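(* Let $W\in\mathbb{R}^{n\times n}$ be a nonnegative row stochastic irreducible matrix, and let $\alpha\in\mathbb{R}^n$ be the vector with nonnegative components such that $\alpha^T W=\alpha^T$ and $\alpha^T\mathbf{1}=1$. Let $\epsilon\in(0,1)$ and let $\tilde\Sigma=\mathrm{diag}(p_1,\dots,p_n)$ be a fixed diagonal matrix with $0<p_i\le 1$ for all $i$ and $\max_i p_i=1$. For $\sigma_M\in(0,1-\epsilon]$ let $$H(\sigma_M)=\sigma_M\left[I-(I-\sigma_M\tilde\Sigma)W\right]^{-1}\tilde\Sigma .$$ Then $$H(\sigma_M)=\mathbf{1}\,\frac{\alpha^T\tilde\Sigma}{\alpha^T\tilde\Sigma\mathbf{1}}+\mathcal{O}(\sigma_M),$$ i.e. there exist $\bar\sigma>0$ and $M>0$ such that $\left\|H(\sigma_M)-\mathbf{1}\,\frac{\alpha^T\tilde\Sigma}{\alpha^T\tilde\Sigma\mathbf{1}}\right\|\le M\sigma_M$ for all $\sigma_M\in(0,\bar\sigma]$.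
   Context: $\mathbf{1}$ denotes the column vector in $\mathbb{R}^n$ with all entries equal to $1$, $I$ is the $n\times n$ identity matrix, and $\|\cdot\|$ is the spectral norm (maximum singular value). A nonnegative square matrix is row stochastic if each row sums to $1$, and irreducible if its associated directed graph is strongly connected. For such $W$, the value $1$ is a simple eigenvalue with right eigenvector $\mathbf{1}$, so the nonnegative normalized left eigenvector $\alpha^T$ exists and is unique. Under the stated hypotheses the matrix $I-(I-\sigma_M\tilde\Sigma)W$ is invertible for every $\sigma_M\in(0,1-\epsilon]$, so $H(\sigma_M)$ is well defined. $H(\sigma_M)$ is the static gain matrix of the Friedkin-Johnsen opinion model $y(k+1)=(I-\Sigma)Wy(k)+\Sigma y_0$, $y(0)=y_0$, with $\Sigma=\sigma_M\tilde\Sigma$. *)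

(* Defs.v *)
(* Library: MathComp + MathComp-Analysis. *)
From HB Require Import structures.
From mathcomp Require Import all_boot all_order all_algebra.
From mathcomp Require Import boolp classical_sets reals.

Set Implicit Arguments.
Unset Strict Implicit.
Unset Printing Implicit Defensive.

Import Order.TTheory GRing.Theory Num.Theory.
Local Open Scope classical_set_scope.
Local Open Scope ring_scope.

Definition ones (R : realType) (n : nat) : 'cV[R]_n := const_mx 1.

Definition nonnegative_mx (R : realType) (m n : nat) (A : 'M[R]_(m, n)) : Prop :=
  forall i j, 0 <= A i j.

Definition row_stochastic (R : realType) (n : nat) (W : 'M[R]_n) : Prop :=
  nonnegative_mx W /\ forall i, \sum_j W i j = 1.

Definition mx_digraph (R : realType) (n : nat) (W : 'M[R]_n) : rel 'I_n :=
  fun i j => W i j != 0.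

Definition irreducible_mx (R : realType) (n : nat) (W : 'M[R]_n) : Prop :=
  forall i j, connect (mx_digraph W) i j.

Definition singular_values (R : realType) (m n : nat) (A : 'M[R]_(m, n)) : set R :=
  [set Num.sqrt a | a in [set a : R | eigenvalue (A^T *m A) a]].

(* For 0 < n the set of singular values is finite and nonempty, so this
   supremum is a maximum. The default norm `|A| of the library is the
   entrywise max norm, not this one. *)
Definition spectral_norm (R : realType) (m n : nat) (A : 'M[R]_(m, n)) : R :=
  sup (singular_values A).

(* Static gain of y(k+1) = (I - Sigma) W y(k) + Sigma y(0) for
   Sigma = sigma *: Sigmat. [invmx] returns its argument on a singular matrix,
   so the definition is meaningful only when the bracket is invertible; this
   holds for W row stochastic and Sigmat diagonal with entries in ]0, 1], for
   every sigma in ]0, 1]. *)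
Definition static_gain (R : realType) (n : nat) (W Sigmat : 'M[R]_n)
    (sigma : R) : 'M[R]_n :=
  sigma *: (invmx (1%:M - (1%:M - sigma *: Sigmat) *m W) *m Sigmat).

Definition limit_gain (R : realType) (n : nat) (alpha : 'cV[R]_n)
    (Sigmat : 'M[R]_n) : 'M[R]_n :=
  ((alpha^T *m Sigmat *m ones R n) 0 0)^-1 *:
    (ones R n *m (alpha^T *m Sigmat)).

(* Main.v *)
(* Write S for Sigmat, c = alpha^T S 1 and A(s) = (I - W) + s S W, so that
   H(s) = s A(s)^-1 S and A(s) 1 = s S 1.  The error
   X = H(s) - 1 alpha^T S / c solves A(s) X = s Q with
   Q = S - S 1 alpha^T S / c.  Since alpha^T (I - W) = 0 and alpha^T Q = 0,
   multiplying on the left by alpha^T gives alpha^T S W X = 0.  Hence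
   K X = s (Q - S W X) with K = (I - W) + 1 alpha^T S W independent of s.
   By irreducibility ker (I - W) is spanned by 1, which makes K invertible, so
   for small s the term s K^-1 S W X is absorbed and X = O(s).  The case
   Q = 0 of the same estimate shows that A(s) is invertible. *)
Require Import Defs.
From HB Require Import structures.
From mathcomp Require Import all_boot all_order all_algebra.
From mathcomp Require Import boolp classical_sets reals.
From mathcomp Require Import lra.

Set Implicit Arguments.
Unset Strict Implicit.

Import Order.TTheory GRing.Theory Num.Theory.
Local Open Scope ring_scope.

Lemma unitmx_inj_mulmx (F : fieldType) (n : nat) (A : 'M[F]_n) :
  (forall x : 'cV[F]_n, A *m x = 0 -> x = 0) -> A \in unitmx.
Proof.
move=> A_inj; rewrite unitmxE unitfE -det_tr; apply/det0P => -[v v_neq0 vA].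
case/eqP: v_neq0; apply: trmx_inj; rewrite trmx0; apply: A_inj.
by apply: trmx_inj; rewrite trmx_mul trmxK trmx0.
Qed.

(** The entrywise l1 norm: it is submultiplicative, invariant under transposition and dominates
    [spectral_norm], so all estimates can be made in it. *)
Definition sum_norm {R : realDomainType} {m n : nat} (A : 'M[R]_(m, n)) : R :=
  \sum_i \sum_j `|A i j|.

Section SumNorm.
Context {R : realDomainType}.

Lemma sum_norm_ge0 m n (A : 'M[R]_(m, n)) : 0 <= sum_norm A.
Proof. by apply: sumr_ge0 => i _; apply: sumr_ge0. Qed.

Lemma sum_norm0 m n : sum_norm (0 : 'M[R]_(m, n)) = 0.
Proof. by apply: big1 => i _; apply: big1 => j _; rewrite mxE normr0. Qed.

Lemma sum_norm_eq0 m n (A : 'M[R]_(m, n)) : sum_norm A = 0 -> A = 0.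
Proof.
move=> A0; apply/matrixP => i j; rewrite mxE; apply/normr0_eq0.
have rows0 := psumr_eq0P (fun i _ => sumr_ge0 _ (fun j _ => normr_ge0 (A i j))) A0.
exact: (psumr_eq0P (fun j _ => normr_ge0 (A i j)) (rows0 i isT)).
Qed.

Lemma sum_normZ m n a (A : 'M[R]_(m, n)) :
  sum_norm (a *: A) = `|a| * sum_norm A.
Proof.
rewrite mulr_sumr; apply: eq_bigr => i _; rewrite mulr_sumr.
by apply: eq_bigr => j _; rewrite mxE normrM.
Qed.

Lemma sum_norm_tr m n (A : 'M[R]_(m, n)) : sum_norm A^T = sum_norm A.
Proof.
rewrite /sum_norm exchange_big; apply: eq_bigr => i _.
by apply: eq_bigr => j _; rewrite mxE.
Qed.

Lemma ler_sum_normB m n (A B : 'M[R]_(m, n)) :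
  sum_norm (A - B) <= sum_norm A + sum_norm B.
Proof.
rewrite -big_split; apply: ler_sum => i _; rewrite -big_split.
by apply: ler_sum => j _; rewrite !mxE ler_normB.
Qed.

Lemma ler_sum_normM m n p (A : 'M[R]_(m, n)) (B : 'M[R]_(n, p)) :
  sum_norm (A *m B) <= sum_norm A * sum_norm B.
Proof.
rewrite /sum_norm mulr_suml; apply: ler_sum => i _.
apply: (@le_trans _ _ (\sum_j \sum_k `|A i k| * `|B k j|)).
  apply: ler_sum => j _; rewrite mxE.
  by apply: le_trans (ler_norm_sum _ _ _) _; apply: ler_sum => k _; rewrite normrM.
rewrite exchange_big mulr_suml; apply: ler_sum => k _.
rewrite -mulr_sumr ler_wpM2l// [leRHS](bigD1 k)//= lerDl.
by apply: sumr_ge0 => l _; apply: sumr_ge0.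
Qed.

End SumNorm.

(** If [v] is a left eigenvector of [A^T *m A] for [a], submultiplicativity gives
    [|a| |v| <= |v| |A|^2], hence [sqrt a <= |A|]. *)
Lemma spectral_norm_le_sum_norm (R : realType) m n (A : 'M[R]_(m, n)) :
  spectral_norm A <= sum_norm A.
Proof.
(* The set is empty when [n = 0]; [sup] then takes its default value 0. *)
have [[s0 s0A]|/nonemptyPn sv0] := pselect (singular_values A !=set0)%classic; last first.
  by rewrite /spectral_norm sv0 sup0 sum_norm_ge0.
apply: ge_sup; first by exists s0.
move=> _ [a /eigenvalueP[v vAA v_neq0] <-].
have v_gt0 : 0 < sum_norm v.
  rewrite lt0r sum_norm_ge0 andbT; apply: contra v_neq0 => /eqP v0.
  exact/eqP/sum_norm_eq0.
rewrite -[leRHS]ger0_norm ?sum_norm_ge0// -sqrtr_sqr ler_wsqrtr//.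
rewrite (le_trans (ler_norm a))// -(ler_pM2r v_gt0) -sum_normZ -vAA.
rewrite (le_trans (ler_sum_normM _ _))// mulrC ler_wpM2r ?sum_norm_ge0//.
by rewrite (le_trans (ler_sum_normM _ _))// sum_norm_tr expr2.
Qed.

(* The entries where x is maximal are closed under the edges of W, because
   x i is a convex combination of the x j over the successors j of i. *)
Lemma irreducible_harmonic_const (R : realType) (n : nat) (W : 'M[R]_n)
    (x : 'cV[R]_n) :
  row_stochastic W -> irreducible_mx W -> W *m x = x ->
  exists t, x = t *: ones R n.
Proof.
case: n W x => [|n] W x [W_ge0 W1] W_irr Wx.
  by exists 0; apply/matrixP => -[].
have [i0 _ x_max] : exists2 i0, true & forall j, x j 0 <= x i0 0.
  case: (arg_maxP (i0 := ord0) (P := xpredT) (fun i => x i 0)) => // i _ xi_max.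
  by exists i => // j; apply: xi_max.
have step i j : x i 0 = x i0 0 -> W i j != 0 -> x j 0 = x i0 0.
  move=> xi Wij.
  (* These nonnegative terms add up to [x i0 0 - x i 0 = 0], so each of them vanishes. *)
  have gap_ge0 k : true -> 0 <= W i k * (x i0 0 - x k 0).
    by move=> _; rewrite mulr_ge0 ?W_ge0// subr_ge0.
  have gap_sum : \sum_k W i k * (x i0 0 - x k 0) = 0.
    under eq_bigr => k _ do rewrite mulrBr.
    rewrite sumrB -mulr_suml W1 mul1r -xi -{1}Wx mxE subrr //.
  have /eqP : W i j * (x i0 0 - x j 0) = 0 := psumr_eq0P gap_ge0 gap_sum isT.
  by rewrite mulf_eq0 (negPf Wij) subr_eq0 => /eqP.
have path_max s : forall i, x i 0 = x i0 0 -> path (mx_digraph W) i s ->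
    x (last i s) 0 = x i0 0.
  by elim: s => //= j s IHs i xi /andP[Wij]; apply: IHs; apply: step Wij.
exists (x i0 0); apply/matrixP => i j; rewrite !mxE mulr1 ord1.
by have /connectP[s Ws ->] := W_irr i0 i; apply: path_max.
Qed.

(** A zero sum of the nonnegative terms [alpha i 0 * p 0 i] would force [alpha = 0], against the
    normalization. *)
Lemma weighted_sum_gt0 (R : realType) (n : nat) (alpha : 'cV[R]_n)
    (p : 'rV[R]_n) :
  nonnegative_mx alpha -> alpha^T *m ones R n = 1%:M -> (forall i, 0 < p 0 i) ->
  0 < (alpha^T *m diag_mx p *m ones R n) 0 0.
Proof.
move=> a_ge0 a1 p_gt0.
have cE : (alpha^T *m diag_mx p *m ones R n) 0 0 = \sum_i alpha i 0 * p 0 i.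
  rewrite mxE; apply: eq_bigr => i _.
  by rewrite mul_mx_diag !mxE mulr1.
have term_ge0 i : true -> 0 <= alpha i 0 * p 0 i.
  by move=> _; rewrite mulr_ge0 ?a_ge0// ltW.
rewrite cE lt0r sumr_ge0// andbT; apply/eqP => /(psumr_eq0P term_ge0) ap0.
have := congr1 (fun M : 'M[R]_1 => M 0 0) a1.
rewrite !mxE big1 => [/eqP|i _]; first by rewrite eq_sym oner_eq0.
have /eqP := ap0 i isT; rewrite mulf_eq0 (gt_eqF (p_gt0 i)) orbF => /eqP ai0.
by rewrite !mxE ai0 mul0r.
Qed.

(** Applying [invmx K] bounds [|X|] by [s |K^-1| |Q|] plus at most half of [|X|]; absorbing that
    half on the left yields the factor 2. *)
Lemma sum_norm_perturbed_solution (R : realType) (n m : nat)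
    (K E : 'M[R]_n) (Q X : 'M[R]_(n, m)) (s : R) :
  K \in unitmx -> 0 <= s -> s * (sum_norm (invmx K) * sum_norm E) <= 2^-1 ->
  K *m X = s *: (Q - E *m X) ->
  sum_norm X <= 2 * sum_norm (invmx K) * sum_norm Q * s.
Proof.
move=> K_unit s_ge0 s_small KX.
have XE : X = s *: (invmx K *m (Q - E *m X)).
  by rewrite scalemxAr -KX mulKmx.
have X_le : sum_norm X <=
    s * (sum_norm (invmx K) * (sum_norm Q + sum_norm E * sum_norm X)).
  rewrite {1}XE sum_normZ ger0_norm// ler_wpM2l//.
  rewrite (le_trans (ler_sum_normM _ _))// ler_wpM2l ?sum_norm_ge0//.
  by rewrite (le_trans (ler_sum_normB _ _))// lerD2l ler_sum_normM.
have absorb := ler_wpM2r (sum_norm_ge0 X) s_small.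
lra.
Qed.

Section ErrorEquation.
Variables (R : realType) (n : nat) (W S : 'M[R]_n) (alpha : 'cV[R]_n).
Hypotheses (alphaW : alpha^T *m W = alpha^T)
  (alpha1 : alpha^T *m ones R n = 1%:M).

(** A rank-one deflation: for row stochastic [W], [K] sends [ones] to [c] times [ones], with
    [c = alpha^T S 1], where [1 - W] sends it to 0. *)
Let K : 'M[R]_n := 1%:M - W + ones R n *m (alpha^T *m S *m W).

(** On a kernel vector [x], [alpha^T] isolates [alpha^T S W x = 0]. Then [W x = x], so [x] is a
    multiple [t] of [ones], and [t c = 0]. *)
Lemma deflated_laplacian_unit :
  row_stochastic W -> irreducible_mx W ->
  (alpha^T *m S *m ones R n) 0 0 != 0 -> K \in unitmx.
Proof.
move=> W_sto W_irr c_neq0; apply: unitmx_inj_mulmx => x Kx.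
have aSWx : alpha^T *m S *m W *m x = 0.
  have := congr1 (mulmx alpha^T) Kx.
  rewrite mulmxDl mulmxBl mul1mx mulmxDr mulmxBr !mulmxA alphaW subrr add0r.
  by rewrite alpha1 mul1mx mulmx0.
have Wx : W *m x = x.
  move: Kx; rewrite mulmxDl -(mulmxA (ones R n)) aSWx mulmx0 addr0 mulmxBl mul1mx.
  by move/eqP; rewrite subr_eq0 => /eqP.
have [t xE] := irreducible_harmonic_const W_sto W_irr Wx.
move: aSWx; rewrite -mulmxA Wx xE -scalemxAr => /matrixP/(_ 0 0)/eqP.
by rewrite mxE [X in _ == X]mxE mulf_eq0 (negPf c_neq0) orbF => /eqP ->; rewrite scale0r.
Qed.

Let bracketE s :
  1%:M - (1%:M - s *: S) *m W = 1%:M - W + s *: (S *m W).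
Proof. by rewrite mulmxBl mul1mx -scalemxAl opprB addrA addrAC. Qed.

Lemma deflated_equation m (Q X : 'M[R]_(n, m)) s :
  s != 0 -> alpha^T *m Q = 0 ->
  (1%:M - (1%:M - s *: S) *m W) *m X = s *: Q ->
  K *m X = s *: (Q - S *m W *m X).
Proof.
move=> s_neq0 aQ; rewrite bracketE => AX.
have LX : (1%:M - W) *m X = s *: (Q - S *m W *m X).
  by rewrite scalerBr -AX (mulmxDl _ (s *: _)) -scalemxAl addrK.
have aSWX : alpha^T *m S *m W *m X = 0.
  have /eqP := congr1 (mulmx alpha^T) LX.
  rewrite mulmxA mulmxBr mulmx1 alphaW subrr mul0mx -scalemxAr mulmxBr aQ sub0r.
  by rewrite eq_sym scaler_eq0 (negPf s_neq0) oppr_eq0 !mulmxA => /eqP.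
by rewrite mulmxDl LX -(mulmxA (ones R n)) aSWX mulmx0 addr0.
Qed.

(** A kernel vector solves the deflated equation with [Q = 0], so the a priori bound makes its norm
    0. *)
Lemma static_gain_bracket_unit s :
  K \in unitmx -> 0 < s ->
  s * (sum_norm (invmx K) * sum_norm (S *m W)) <= 2^-1 ->
  1%:M - (1%:M - s *: S) *m W \in unitmx.
Proof.
move=> K_unit s_gt0 s_small; apply: unitmx_inj_mulmx => x Ax.
apply: sum_norm_eq0; apply/le_anti; rewrite sum_norm_ge0 andbT.
rewrite (le_trans (sum_norm_perturbed_solution (Q := 0) K_unit _ s_small _))//.
- exact: ltW.
- by apply: deflated_equation; rewrite ?gt_eqF ?mulmx0 ?Ax ?scaler0.
- by rewrite sum_norm0 mulr0 mul0r.
Qed.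

Lemma gain_error_equation s :
  W *m ones R n = ones R n -> 1%:M - (1%:M - s *: S) *m W \in unitmx ->
  (1%:M - (1%:M - s *: S) *m W) *m (static_gain W S s - limit_gain alpha S) =
  s *: (S - S *m limit_gain alpha S).
Proof.
move=> W1 A_unit.
have A1 : (1%:M - (1%:M - s *: S) *m W) *m ones R n = s *: (S *m ones R n).
  by rewrite bracketE mulmxDl mulmxBl mul1mx W1 subrr add0r -scalemxAl -mulmxA W1.
rewrite mulmxBr /static_gain -scalemxAr mulKVmx// scalerBr; congr (_ - _).
by rewrite /limit_gain -!scalemxAr !mulmxA A1 -!scalemxAl !scalerA mulrC.
Qed.

(** The scalar [alpha^T S 1] produced by the product cancels the normalizing factor of
    [limit_gain]. *)
Lemma left_eigen_residual0 :
  (alpha^T *m S *m ones R n) 0 0 != 0 ->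
  alpha^T *m (S - S *m limit_gain alpha S) = 0.
Proof.
rewrite /limit_gain; set c := (_ *m ones R n) 0 0 => c_neq0.
rewrite mulmxBr -!scalemxAr !mulmxA -(mulmxA _ alpha^T).
rewrite [_ *m ones R n]mx11_scalar -/c mul_scalar_mx.
by rewrite scalerA mulVf// scale1r subrr.
Qed.

End ErrorEquation.

Theorem theorem1 (R : realType) (n : nat) (W : 'M[R]_n) (alpha : 'cV[R]_n)
    (eps : R) (p : 'rV[R]_n)
    (W_stochastic : row_stochastic W) (W_irreducible : irreducible_mx W)
    (alpha_ge0 : nonnegative_mx alpha)
    (alpha_left_eigen : alpha^T *m W = alpha^T)
    (alpha_normalized : alpha^T *m ones R n = 1%:M)
    (eps_bounds : 0 < eps < 1)
    (p_bounds : forall i, 0 < p 0 i <= 1)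
    (p_max : \big[Num.max/0]_(i < n) p 0 i = 1) :
  exists sigmabar M : R,
    [/\ 0 < sigmabar <= 1 - eps, 0 < M &
        forall sigmaM : R, 0 < sigmaM <= sigmabar ->
          spectral_norm (static_gain W (diag_mx p) sigmaM
                         - limit_gain alpha (diag_mx p)) <= M * sigmaM].
Proof.
set S := diag_mx p.
have c_neq0 : (alpha^T *m S *m ones R n) 0 0 != 0.
  rewrite gt_eqF//; apply: weighted_sum_gt0 => // i.
  by case/andP: (p_bounds i).
have W1 : W *m ones R n = ones R n.
  apply/matrixP => i j; rewrite !mxE -[RHS](W_stochastic.2 i).
  by apply: eq_bigr => k _; rewrite mxE mulr1.
have K_unit := deflated_laplacian_unit (S := S) alpha_left_eigen
  alpha_normalized W_stochastic W_irreducible c_neq0.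
set K := (X in X \in unitmx) in K_unit.
set d := sum_norm (invmx K) * sum_norm (S *m W).
set q := sum_norm (S - S *m limit_gain alpha S).
have d_ge0 : 0 <= d by rewrite mulr_ge0 ?sum_norm_ge0.
have d1_gt0 : 0 < 2 * (d + 1) by lra.
(* The second bound on [s] gives [s * d <= 1/2]; [d + 1] avoids inverting 0 when [d = 0]. The [+ 1]
   in the constant only secures its strict positivity. *)
exists (Num.min (1 - eps) (2 * (d + 1))^-1), (2 * sum_norm (invmx K) * q + 1).
split.
- rewrite lt_min invr_gt0 d1_gt0 ge_min lexx /= !andbT.
  by case/andP: eps_bounds => _; rewrite subr_gt0.
- by rewrite ltr_wpDl// !mulr_ge0 ?sum_norm_ge0.
move=> s /andP[s_gt0]; rewrite le_min => /andP[_ s_le].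
have s_small : s * d <= 2^-1.
  have : s * (2 * (d + 1)) <= 1 by rewrite -ler_pdivlMr// div1r.
  lra.
have A_unit := static_gain_bracket_unit alpha_left_eigen K_unit s_gt0 s_small.
apply: le_trans (spectral_norm_le_sum_norm _) _.
have KX := deflated_equation alpha_left_eigen (lt0r_neq0 s_gt0)
  (left_eigen_residual0 c_neq0) (gain_error_equation _ W1 A_unit).
apply: le_trans (sum_norm_perturbed_solution K_unit (ltW s_gt0) s_small KX) _.
by rewrite ler_wpM2r ?lerDl// ltW.
Qed.
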